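(* Let $(X,T)$ be a minimal system. Then the following statements are equivalent: (1) $(X,T)$ is broken $\mathcal{F}_{pubd}$-sensitive; (2) $(X,T)$ is not mean equicontinuous; (3) $(X,T)$ is not a Banach proximal extension of its maximal equicontinuous factor.
   Context: A (topological dynamical) system $(X,T)$ is a compact metric space $X$ with metric $d$ and a continuous surjective map $T\colon X\to X$; it is minimal if it has no proper non-empty closed $T$-invariant subset. $\mathbb{Z}_+=\{0,1,2,\dots\}$, $\mathbb{N}=\{1,2,\dots\}$. ''Opene'' means non-empty open. The upper Banach density of $A\subset\mathbb{Z}_+$ is $\limsup_{b-a\to\infty}\frac{|A\cap\{a,a+1,\dots,b-1\}|}{b-a}$. $\mathcal{F}_{pubd}$ is the family of subsets of $\mathbb{Z}_+$ with positive upper Banach density. For a family $\mathcal{F}$ of subsets of $\mathbb{Z}_+$, $(X,T)$ is broken $\mathcal{F}$-sensitive (i.e. broken $\mathcal{F}$-$2$-sensitive) if there exist $\delta>0$ and $F\in\mathcal{F}$ such that for every opene $U\subset X$ and every $l\in\mathbb{N}$ there exist $x_1^l,x_2^l\in U$ and $m_l\in\mathbb{Z}_+$ with $d(T^kx_1^l,T^kx_2^l)>\delta$ for all $k\in m_l+(F\cap[1,l])$. $(X,T)$ is mean equicontinuous if for every $\varepsilon>0$ there is $\delta>0$ such that $d(x,y)<\delta$ implies $\limsup_{m\to\infty}\frac1m\sum_{k=0}^{m-1}d(T^kx,T^ky)<\varepsilon$. A factor map $\pi\colon(X,T)\to(Y,S)$ is a continuous surjection with $\pi\circ T=S\circ\pi$.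 A system is equicontinuous if for every $\varepsilon>0$ there is $\delta>0$ such that $d(x,y)<\delta$ implies $d(T^mx,T^my)<\varepsilon$ for all $m\in\mathbb{N}$. The maximal equicontinuous factor $(X_{eq},T_{eq})$ is the equicontinuous factor of $(X,T)$ such that every equicontinuous factor of $(X,T)$ is a factor of it; it is the quotient of $X$ by the smallest closed $T\times T$-invariant equivalence relation with equicontinuous quotient, and $\pi\colon X\to X_{eq}$ denotes the quotient map. A pair $(x_1,x_2)$ is Banach proximal if for every $\varepsilon>0$, $d(T^mx_1,T^mx_2)<\varepsilon$ for all $m\in\mathbb{Z}_+$ except a set of zero (upper) Banach density. $(X,T)$ is a Banach proximal extension of $(Y,S)$ via $\pi$ if every pair $(x_1,x_2)$ with $\pi(x_1)=\pi(x_2)$ is Banach proximal. *)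

(* Defs.v *)
From HB Require Import structures.
From mathcomp Require Import all_boot all_order all_algebra.
From mathcomp Require Import all_classical all_reals all_analysis.

Set Implicit Arguments.
Unset Strict Implicit.
Unset Printing Implicit Defensive.

Import Order.TTheory GRing.Theory Num.Theory.
Import numFieldNormedType.Exports.

Local Open Scope classical_set_scope.
Local Open Scope ring_scope.

(* The filter on pairs (a, b) describing the limit b - a --> oo.  The condition
   is written additively because subtraction on nat is truncated. *)
Definition long_intervals : set_system (nat * nat) :=
  filter_from [set: nat] (fun N => [set ab | (ab.1 + N <= ab.2)%N]).

Definition upper_banach_density (R : realType) (A : set nat) : \bar R :=
  limf_esup (fun ab : nat * nat =>
    ((\sum_(ab.1 <= k < ab.2) (k \in A))%:R / (ab.2 - ab.1)%:R)%:E)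
    long_intervals.

Definition F_pubd (R : realType) : set (set nat) :=
  [set A | (0 < upper_banach_density R A)%E].

Section dynamics.
Context {R : realType}.
Implicit Types X Y Z : metricType R.

(* The phase space is required to be non-empty, since metricType allows the
   empty space; on the empty space every property below quantifying over
   points or over non-empty open sets would hold vacuously. *)
Definition is_system X (T : X -> X) : Prop :=
  [/\ [set: X] !=set0, compact [set: X], continuous T
    & set_surj [set: X] [set: X] T].

Definition is_minimal X (T : X -> X) : Prop :=
  forall A : set X,
    closed A -> A !=set0 -> T @` A `<=` A -> A = [set: X].

Definition broken_sensitive (Fam : set (set nat)) X (T : X -> X) : Prop :=
  exists delta : R, 0 < delta /\ exists F : set nat, Fam F /\
    forall U : set X, open U -> U !=set0 ->
    forall l : nat, (0 < l)%N ->
    exists x1 x2 : X, exists m : nat, [/\ U x1, U x2 &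
      forall k, [set (m + j)%N | j in F `&` [set j | (1 <= j <= l)%N]] k ->
        delta < mdist (iter k T x1) (iter k T x2)].

Definition mean_equicontinuous X (T : X -> X) : Prop :=
  forall eps : R, 0 < eps -> exists delta : R, 0 < delta /\
    forall x y : X, mdist x y < delta ->
    (limn_esup (fun m : nat =>
       (m%:R^-1 * \sum_(0 <= k < m) mdist (iter k T x) (iter k T y))%:E)
     < eps%:E)%E.

Definition equicontinuous_system X (T : X -> X) : Prop :=
  forall eps : R, 0 < eps -> exists delta : R, 0 < delta /\
    forall x y : X, mdist x y < delta ->
    forall m : nat, (0 < m)%N -> mdist (iter m T x) (iter m T y) < eps.

Definition factor_map X (T : X -> X) Y (S : Y -> Y) (pi : X -> Y) : Prop :=
  [/\ continuous pi, set_surj [set: X] [set: Y] pi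
    & forall x, pi (T x) = S (pi x)].

Definition equicontinuous_factor X (T : X -> X) Y (S : Y -> Y) (pi : X -> Y) :
    Prop :=
  [/\ is_system S, equicontinuous_system S & factor_map T S pi].

(* The universal property is compatible with the factor maps: in terms of
   kernels, the closed invariant equivalence relation [pi x = pi y] is contained
   in that of any other equicontinuous factor.  Hence (Y, S) is the quotient of
   X by the smallest such relation, with quotient map pi, and (Y, S, pi) is
   unique up to conjugacy. *)
Definition is_max_equicontinuous_factor
    X (T : X -> X) Y (S : Y -> Y) (pi : X -> Y) : Prop :=
  equicontinuous_factor T S pi /\
  forall Z (Q : Z -> Z) (phi : X -> Z), equicontinuous_factor T Q phi ->
    exists2 psi : Y -> Z, factor_map S Q psi & forall x, phi x = psi (pi x).

Definition banach_proximal X (T : X -> X) (x1 x2 : X) : Prop :=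
  forall eps : R, 0 < eps ->
    upper_banach_density R
      [set m | ~ (mdist (iter m T x1) (iter m T x2) < eps)] = 0%E.

Definition banach_proximal_extension X (T : X -> X) Y (pi : X -> Y) : Prop :=
  forall x1 x2 : X, pi x1 = pi x2 -> banach_proximal T x1 x2.

(* "The" maximal equicontinuous factor always exists and is unique up to
   conjugacy over X, so quantifying over its realizations existentially or
   universally gives the same notion. *)
Definition banach_proximal_extension_of_mef X (T : X -> X) : Prop :=
  exists Y (S : Y -> Y) (pi : X -> Y),
    is_max_equicontinuous_factor T S pi /\ banach_proximal_extension T pi.

End dynamics.

(* Main.v *)
From HB Require Import structures.
Require Import Defs.
From mathcomp Require Import all_boot all_order all_algebra.
From mathcomp Require Import all_classical all_reals all_analysis.
From mathcomp Require Import lra.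
Set Implicit Arguments.
Unset Strict Implicit.
Unset Printing Implicit Defensive.
Import Order.TTheory GRing.Theory Num.Theory.
Import numFieldNormedType.Exports.
Local Open Scope classical_set_scope.
Local Open Scope ring_scope.

(**
Write S_(a,b)(x,y) for the sum of d(T^k x, T^k y) over a <= k < b, and D(x,y)
for the limit superior of S_(0,n)(x,y) / n. Two elementary devices carry the
proof.

The first is a tiling argument. If from every position some window of length
at most L has average at most c, then those windows tile every long interval,
so all long averages are at most c up to a boundary term ([tiling]).
Contrapositively, if the averages exceed e along infinitely many prefixes,
then for every c < e and L there are arbitrarily late positions from which all
windows of length up to L have average above c ([persistent_window]).

The second is compactness. Let rho be a continuous function on X * X such that
D vanishes wherever rho <= 0. Near the set rho <= 0 every pair has a window of
bounded length with a small average, so a pair whose whole orbit stays near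
that set has uniformly small averages over all long intervals, wherever they
start ([Banach_mean_bound]).

From mean equicontinuity to Banach proximality. Mean equicontinuity makes D a
continuous pseudometric for which T is nonexpanding, hence X/D is a compact
equicontinuous factor. Points with D(x,y) = 0 are proximal, and an
equicontinuous surjective system has no nontrivial proximal pair, so every
equicontinuous factor factors through X/D: this is the maximal one
([mean_quotient_max]). Taking rho = D in [Banach_mean_bound] shows that D(x,y)
= 0 forces all long averages of d(T^k x, T^k y) to be small, which is Banach
proximality.

From Banach proximality to mean equicontinuity. Take rho(x,y) to be the
distance between the images of x and y in the factor. Equicontinuity keeps the
image orbits of nearby points close, so [Banach_mean_bound] applies to all
pairs of nearby points ([banach_proximal_extension_mean_equicontinuous]).

Broken sensitivity excludes mean equicontinuity. Under mean equicontinuity,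
averages over long intervals are small uniformly in the interval, for all
pairs of nearby points ([mean_equicontinuous_Banach]); a separation pattern of
positive upper Banach density realised by such a pair would contradict this.

Failure of mean equicontinuity gives broken sensitivity. Without mean
equicontinuity, some point z is accumulated by pairs x_n, y_n with D(x_n, y_n)
bounded below. By [persistent_window] there are times m_n >= n from which all
windows of length up to n have a large average. Any accumulation point (p, q)
of (T^(m_n) x_n, T^(m_n) y_n) then has large averages over all prefixes, so
the times F at which T^k p and T^k q are well separated have positive density,
and every finite piece of F is realised at time m_n by a pair arbitrarily
close to z. By minimality the orbit of z enters any non-empty open set U, say
at time n_0. Then T^(n_0) sends these pairs into U, and they realise the same
piece of F at time m_n - n_0 ([minimal_not_mean_equicontinuous_broken]).
*)

(** * Upper limits and densities as bounds on real sequences *)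

Lemma limf_esup_lt_near (R : realType) (T : choiceType) (X : filteredType T)
    (f : X -> \bar R) (F : set_system X) (c : \bar R) :
  Filter F -> (limf_esup f F < c)%E -> F [set x | (f x < c)%E].
Proof.
move=> FF /ereal_inf_lt[_ [V FV <-] supVc]; apply: filterS FV => x Vx /=.
by apply: le_lt_trans supVc; apply: ereal_sup_ubound; exists x.
Qed.

Lemma limf_esup_le_near (R : realType) (T : choiceType) (X : filteredType T)
    (f : X -> \bar R) (F : set_system X) (c : \bar R) :
  F [set x | (f x <= c)%E] -> (limf_esup f F <= c)%E.
Proof.
move=> Fc; apply: ge_ereal_inf; eexists; first by exists [set x | (f x <= c)%E].
by apply: ge_ereal_sup => _ [x xc <-].
Qed.

Lemma natr_large (R : realType) (r : R) : exists N, forall n, (N <= n)%N -> r < n%:R.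
Proof.
exists (Num.truncn r).+1 => n Nn.
by rewrite (lt_le_trans (truncnS_gt _))// ler_nat.
Qed.

Lemma inv_small (R : realType) (e : R) : 0 < e ->
  exists N, forall n, (N <= n)%N -> n.+1%:R^-1 < e.
Proof.
move=> e0; have [N HN] := natr_large e^-1; exists N => n /leqW /HN ne.
by rewrite invf_plt ?posrE.
Qed.


Section density.
Context {R : realType}.

(** The count is taken in [nat] before the cast so that it is literally the
    numerator in the definition of the upper Banach density. *)
Definition visits (A : set nat) (a b : nat) : R :=
  (\sum_(a <= k < b) (k \in A))%:R.

Definition Banach_null (A : set nat) := forall c : R, 0 < c ->
  exists N, forall a b, (a + N <= b)%N -> visits A a b <= c * (b - a)%:R.

#[local] Instance long_intervals_filter : Filter long_intervals.
Proof.
apply: filter_from_filter; first by exists 0%N.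
move=> i j _ _; exists (maxn i j) => // -[a b] /= abij; split => /=.
  by rewrite (leq_trans _ abij)// leq_add2l leq_maxl.
by rewrite (leq_trans _ abij)// leq_add2l leq_maxr.
Qed.

Lemma upper_banach_density_le0P A :
  (upper_banach_density R A <= 0)%E <-> Banach_null A.
Proof.
split=> [A0 c c0|A0].
  have Ac : (upper_banach_density R A < c%:E)%E by rewrite (le_lt_trans A0)// lte_fin.
  have [N _ HN] := limf_esup_lt_near long_intervals_filter Ac.
  exists N => a b abN; have := HN (a, b) abN; rewrite /= lte_fin => /ltW.
  have [ab|ab] := ltnP a b; first by rewrite ler_pdivrMr ?ltr0n ?subn_gt0.
  by rewrite /visits big_geq// mulr_ge0// ltW.
apply/lee_addgt0Pr => c c0; rewrite add0e; apply: limf_esup_le_near.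
have [N HN] := A0 _ c0; exists N => // -[a b] /= abN; rewrite lee_fin.
have [ab|ab] := ltnP a b; first by rewrite ler_pdivrMr ?ltr0n ?subn_gt0// HN.
by rewrite (eqP ab) invr0 mulr0 ltW.
Qed.

Lemma upper_banach_density_eq0P A :
  upper_banach_density R A = 0%E <-> Banach_null A.
Proof.
rewrite -upper_banach_density_le0P; split=> [->//|A0]; apply/eqP.
rewrite eq_le A0/=; apply: limf_esup_ge0 => [[N _ /(_ (0%N, N))]|ab].
  by apply => /=.
by rewrite lee_fin divr_ge0// ler0n.
Qed.

Lemma F_pubdP (A : set nat) : F_pubd R A <-> exists2 c : R, 0 < c &
  forall N, exists a b, (a + N <= b)%N /\ c * (b - a)%:R < visits A a b.
Proof.
have -> : F_pubd R A = ~ Banach_null A.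
  by rewrite propeqE -upper_banach_density_le0P leNgt; split=> [?|/negP];
    [apply/negP|]; rewrite negbK.
split=> [|[c c0 cA] /(_ c c0)[N HN]].
  move/existsNP => [c /not_implyP[c0 cA]]; exists c => // N.
  apply: contrapT => nab; apply: cA; exists N => a b abN.
  by rewrite leNgt; apply/negP => cab; apply: nab; exists a, b.
by have [a [b [/HN]]] := cA N; rewrite leNgt => /negP.
Qed.

End density.

(** * Block averages *)

Lemma sumr_le_const (R : realType) (u : nat -> R) (B : R) (m n : nat) :
  (forall k, u k <= B) -> \sum_(m <= k < n) u k <= (n - m)%:R * B.
Proof. by move=> uB; rewrite mulr_natl -sumr_const_nat ler_sum. Qed.

Lemma sumr_ge_const (R : realType) (u : nat -> R) (B : R) (m n : nat) :
  (forall k, B <= u k) -> (n - m)%:R * B <= \sum_(m <= k < n) u k.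
Proof. by move=> uB; rewrite mulr_natl -sumr_const_nat ler_sum. Qed.

(** Cover the interval greedily by good windows.  Only the last piece, of length
    at most [L], may fail to be good, and it contributes at most [L * B]. *)
Lemma tiling (R : realType) (u : nat -> R) (B c : R) (L M : nat) :
  0 <= B -> 0 <= c -> (forall k, u k <= B) ->
  (forall m, (M <= m)%N -> exists j, [/\ (0 < j)%N, (j <= L)%N &
     \sum_(m <= k < m + j) u k <= c * j%:R]) ->
  forall m n, (M <= m)%N -> \sum_(m <= k < m + n) u k <= c * n%:R + L%:R * B.
Proof.
move=> B0 c0 uB HL m n; have [k] := ubnP n.
elim: k m n => // k IHk m n nk Mm; have [nL|Ln] := leqP n L.
  rewrite -[leLHS]add0r lerD ?mulr_ge0//.
  rewrite (le_trans (sumr_le_const _ _ uB))// addKn.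
  by rewrite ler_wpM2r// ler_nat.
have [j [j0 jL uj]] := HL _ Mm; have jn := leq_trans jL (ltnW Ln).
have := IHk (m + j)%N (n - j)%N; rewrite -addnA subnKC// => IH.
rewrite (@big_cat_nat _ _ _ (m + j))/= ?leq_addr ?leq_add2l//.
rewrite -[in n%:R](subnKC jn) natrD mulrDr -addrA lerD// IH//.
  by rewrite (@leq_trans n)// ltn_subrL j0 (leq_trans j0).
by rewrite (leq_trans Mm)// leq_addr.
Qed.

(** Otherwise good windows would start at every position from [M] on, and
    [tiling] would bound all long averages by [c], up to a term that the gap
    between [c] and [e] absorbs. *)
Lemma persistent_window (R : realType) (u : nat -> R) (B c e : R) :
  0 <= c -> c < e -> (forall k, 0 <= u k <= B) ->
  ~ (\forall n \near \oo, \sum_(0 <= k < n) u k <= e * n%:R) ->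
  forall M L, exists2 m, (M <= m)%N & forall j, (0 < j)%N -> (j <= L)%N ->
    c * j%:R < \sum_(m <= k < m + j) u k.
Proof.
move=> c0 ce uB une M L; apply: contrapT => nm; apply: une.
have B0 : 0 <= B by have /andP[/le_trans h /h] := uB 0%N.
have til := @tiling _ u B c L M B0 c0 (fun k => proj2 (andP (uB k))).
have [N HN] := natr_large ((M%:R * B + L%:R * B) / (e - c)).
have {}til m n : (M <= m)%N -> \sum_(m <= k < m + n) u k <= c * n%:R + L%:R * B.
  apply: til => m' Mm'; apply: contrapT => nj; apply: nm; exists m' => // j j0 jL.
  by rewrite ltNge; apply/negP => uj; apply: nj; exists j.
exists (M + N)%N => // n /= MNn.
have Mn : (M <= n)%N by rewrite (leq_trans _ MNn)// leq_addr.
rewrite (@big_cat_nat _ _ _ M)//=.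
have := til M (n - M)%N (leqnn _); rewrite subnKC// => h2.
have h1 : \sum_(0 <= k < M) u k <= M%:R * B.
  rewrite -[X in X%:R * B](subn0 M); apply: sumr_le_const => k.
  by case/andP: (uB k).
have : (M%:R * B + L%:R * B) / (e - c) < n%:R.
  by apply: HN; rewrite (leq_trans _ MNn)// leq_addl.
rewrite ltr_pdivrMr ?subr_gt0// => h3.
have h4 : c * (n - M)%:R <= c * n%:R by rewrite ler_wpM2l// ler_nat leq_subr.
lra.
Qed.

(** * Compactness through accumulation points *)

(** Stated for topological spaces so that it applies to products of metric spaces,
    where the components of a sequence of tuples accumulate along the same
    indices. *)
Lemma compact_accumulation (K : topologicalType) (w : nat -> K) :
  compact [set: K] ->
  exists p : K, forall V, nbhs p V -> forall N, exists2 n, (N <= n)%N & V (w n).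
Proof.
move=> /(_ (w @ \oo) _ filterT)[p [_ clp]]; exists p => V pV N.
have FN : (w @ \oo) (w @` [set n | (N <= n)%N]).
  by exists N => // n /= Nn; exists n.
by have [_ [[n /= Nn <-] Vn]] := clp _ V FN pV; exists n.
Qed.

Lemma compact_setTX (K L : topologicalType) :
  compact [set: K] -> compact [set: L] -> compact [set: K * L].
Proof. by rewrite -setXTT; exact: compact_setX. Qed.

Section accumulation.
Context {R : realType} {K : topologicalType} {w : nat -> K} {p : K}.
Hypothesis wp :
  forall V, nbhs p V -> forall N, exists2 n, (N <= n)%N & V (w n).

(** The hypothesis asks that the values of [g] along the sequence be eventually
    below [c + e], so that it also applies when they only tend to [c]. *)
Lemma accumulation_le (g : K -> R) (c : R) : {for p, continuous g} ->
  (forall e, 0 < e -> exists N, forall n, (N <= n)%N -> g (w n) < c + e) -> g p <= c.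
Proof.
move=> gp gc; apply/ler_addgt0Pr => e e0; have e2 : 0 < e / 2 by lra.
have [N HN] := gc _ e2.
have /wp/(_ N)[n /HN gn] : nbhs p [set q | `|g p - g q| < e / 2].
  by have /cvgrPdist_lt/(_ _ e2) := gp.
rewrite /= ltr_norml; lra.
Qed.

Lemma accumulation_ge (g : K -> R) (c : R) (N : nat) : {for p, continuous g} ->
  (forall n, (N <= n)%N -> c <= g (w n)) -> c <= g p.
Proof.
move=> gp gc; rewrite -lerN2; apply: (@accumulation_le (fun q => - g q)).
  exact: continuousN.
by move=> e e0; exists N => n /gc; lra.
Qed.

End accumulation.

(** Otherwise there are points with [g] tending to 0 and [h] at least [e]; an
    accumulation point contradicts the implication.  With [g] the metric on
    pairs this is the Heine-Cantor theorem. *)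
Lemma compact_null_domination (R : realType) (K : topologicalType)
    (g h : K -> R) :
  compact [set: K] -> continuous g -> continuous h ->
  (forall p, g p <= 0 -> h p <= 0) ->
  forall e, 0 < e -> exists2 d, 0 < d & forall p, g p < d -> h p < e.
Proof.
move=> cK cg ch gh e e0; apply: contrapT => nd.
have bad n : exists p, g p < n.+1%:R^-1 /\ e <= h p.
  apply: contrapT => np; apply: nd; exists n.+1%:R^-1 => // p gp.
  by rewrite ltNge; apply/negP => hp; apply: np; exists p.
have [w Hw] := choice bad; have [p wp] := compact_accumulation w cK.
have : h p <= 0.
  apply: gh; apply: (accumulation_le wp (cg p)) => d d0.
  have [N HN] := inv_small d0; exists N => n Nn; rewrite add0r.
  by rewrite (lt_trans (Hw n).1)// HN.
suff : e <= h p by lra.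
by apply: (accumulation_ge wp (N := 0) (ch p)) => n _; case: (Hw n).
Qed.

Lemma compact_bounded_above (R : realType) (K : topologicalType) (g : K -> R) :
  compact [set: K] -> continuous g -> exists2 B, 0 < B & forall p, g p <= B.
Proof.
move=> cK cg; apply: contrapT => nB.
have bad n : exists p, n.+1%:R <= g p.
  apply: contrapT => np; apply: nB; exists n.+1%:R => // p.
  by apply/ltW; rewrite ltNge; apply/negP => gp; apply: np; exists p.
have [w Hw] := choice bad; have [p wp] := compact_accumulation w cK.
have [N HN] := natr_large (g p).
have := HN N (leqnn N); rewrite ltNge => /negP; apply.
apply: (accumulation_ge wp (N := N) (cg p)) => n Nn.
by rewrite (le_trans _ (Hw n))// ler_nat leqW.
Qed.

(** * Continuous pseudometrics *)

Definition is_pseudometric (R : realType) (X : Type) (rho : X * X -> R) :=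
  [/\ forall x, rho (x, x) = 0, forall x y, rho (x, y) = rho (y, x)
    & forall x y z, rho (x, z) <= rho (x, y) + rho (y, z)].

Lemma pseudometric_ge0 (R : realType) (X : Type) (rho : X * X -> R) p :
  is_pseudometric rho -> 0 <= rho p.
Proof.
case: p => x y [r0 rs rt]; have := rt x y x; rewrite r0 (rs y x); lra.
Qed.

Lemma nbhs_mdist (R : realType) (X : metricType R) (x : X) (V : set X) :
  nbhs x V <-> exists2 d : R, 0 < d & forall y, mdist x y < d -> V y.
Proof. by rewrite -metricType_numDomainType.filter_from_mdist_nbhs. Qed.

(** By the triangle inequality a pseudometric varies by at most
    [rho (x, x') + rho (y, y')], so continuity at diagonal points suffices. *)
Lemma pseudometric_continuous (R : realType) (X : metricType R)
    (rho : X * X -> R) : is_pseudometric rho ->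
  (forall x e, 0 < e -> exists2 d : R, 0 < d &
    forall y, mdist x y < d -> rho (x, y) < e) ->
  continuous rho.
Proof.
move=> [r0 rs rt] rc [x y]; apply/cvgrPdist_lt => e e0.
have e2 : 0 < e / 2 by lra.
exists ([set x' | rho (x, x') < e / 2], [set y' | rho (y, y') < e / 2]) => /=.
  by split; apply/nbhs_mdist; apply: rc.
move=> [x' y'] [/= xx' yy']; rewrite ltr_norml.
have := rt x x' y; have := rt x' y' y; have := rt x' x y'; have := rt x y y'.
rewrite (rs x' x) (rs y' y); lra.
Qed.

Lemma epsilon_delta_continuous (R : realType) (X Y : metricType R) (f : X -> Y) :
  (forall x (e : R), 0 < e -> exists2 d : R, 0 < d &
    forall y, mdist x y < d -> mdist (f x) (f y) < e) ->
  continuous f.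
Proof.
move=> Hf x V /nbhs_mdist[e e0 HV]; apply/nbhs_mdist.
by have [d d0 Hd] := Hf x e e0; exists d => // y /Hd/HV.
Qed.

Lemma pseudometric_pullback (R : realType) (X Y : Type) (f : X -> Y)
    (rho : Y * Y -> R) :
  is_pseudometric rho -> is_pseudometric (fun p => rho (f p.1, f p.2)).
Proof. by move=> [r0 rs rt]; split=> *. Qed.

Lemma mdist_pseudometric (R : realType) (X : metricType R) :
  is_pseudometric (fun p : X * X => mdist p.1 p.2).
Proof. by split=> *; [exact: mdistxx|exact: metric_sym|exact: metric_triangle]. Qed.

Lemma continuous_mdist_pullback (R : realType) (X Y : metricType R) (f : X -> Y) :
  continuous f -> continuous (fun p : X * X => mdist (f p.1) (f p.2)).
Proof.
move=> cf; apply: pseudometric_continuous.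
  exact: (pseudometric_pullback f (@mdist_pseudometric R Y)).
move=> x e e0; apply/nbhs_mdist; apply: (cf x [set y | mdist (f x) y < e]).
by apply/nbhs_mdist; exists e.
Qed.

Lemma continuous_mdist (R : realType) (X : metricType R) :
  continuous (fun p : X * X => mdist p.1 p.2).
Proof. by apply: (@continuous_mdist_pullback _ X X id) => x; exact: cvg_id. Qed.

(** * Orbit averages of a pair of points *)

Section orbit_sums.
Context {R : realType} {X : metricType R}.
Variable T : X -> X.
Implicit Types p : (X * X)%type.

Definition orbit_dist k p : R := mdist (iter k T p.1) (iter k T p.2).

Definition orbit_sum a b p : R := \sum_(a <= k < b) orbit_dist k p.

Definition mean_le (c : R) p :=
  \forall n \near \oo, orbit_sum 0 n p <= c * n%:R.

Lemma orbit_dist_ge0 k p : 0 <= orbit_dist k p.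
Proof. exact: mdist_ge0. Qed.

Lemma orbit_sum_ge0 a b p : 0 <= orbit_sum a b p.
Proof. by apply: sumr_ge0 => k _; exact: orbit_dist_ge0. Qed.

Lemma orbit_sum_shift m a b p :
  orbit_sum (m + a) (m + b) p = orbit_sum a b (iter m T p.1, iter m T p.2).
Proof.
rewrite /orbit_sum !(addnC m) big_addn addnK; apply: eq_bigr => k _.
by rewrite /orbit_dist /= -!iterD.
Qed.

Lemma iter_continuous k : continuous T -> continuous (iter k T).
Proof.
move=> cT; elim: k => [|k IHk] x; first exact: cvg_id.
by apply: (@continuous_comp _ _ _ (iter k T) T); [exact: IHk|exact: cT].
Qed.

Lemma orbit_dist_continuous k : continuous T -> continuous (orbit_dist k).
Proof. by move=> cT; apply/continuous_mdist_pullback/iter_continuous. Qed.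

Lemma orbit_sum_continuous a b : continuous T -> continuous (orbit_sum a b).
Proof.
move=> cT p; apply: cvg_big => [|k _]; first exact: add_continuous.
exact: orbit_dist_continuous.
Qed.

(** Passing from a strict to a weak inequality, here and in the converse below, is
    harmless because the constant always ranges over all positive reals. *)
Lemma limn_esup_mean_le c p :
  (limn_esup (fun m => (m%:R^-1 * orbit_sum 0 m p)%:E) < c%:E)%E -> mean_le c p.
Proof.
move=> /(limf_esup_lt_near eventually_filter) pc; apply: filterS pc => -[_|n].
  by rewrite /orbit_sum big_geq// mulr0.
by rewrite /= lte_fin mulrC => /ltW; rewrite ler_pdivrMr ?ltr0n.
Qed.

Lemma mean_le_limn_esup c p : 0 <= c -> mean_le c p ->
  (limn_esup (fun m => (m%:R^-1 * orbit_sum 0 m p)%:E) <= c%:E)%E.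
Proof.
move=> c0 pc; apply: limf_esup_le_near; apply: filterS pc => -[_|n pn] /=.
  by rewrite invr0 mul0r lee_fin.
by rewrite lee_fin mulrC ler_pdivrMr ?ltr0n.
Qed.

Lemma mean_equicontinuousP : mean_equicontinuous T <->
  forall e, 0 < e -> exists2 d : R, 0 < d & forall p, mdist p.1 p.2 < d -> mean_le e p.
Proof.
split=> H e e0.
  have [d [d0 Hd]] := H e e0; exists d => // -[x y] xy.
  exact: (limn_esup_mean_le (Hd _ _ xy)).
have e2 : 0 < e / 2 by lra.
have [d d0 Hd] := H _ e2; exists d; split=> // x y xy.
rewrite (le_lt_trans (mean_le_limn_esup (ltW e2) (Hd (x, y) xy)))// lte_fin; lra.
Qed.

Lemma mean_le_orbit_dist_small p e : 0 < e -> (forall c, 0 < c -> mean_le c p) ->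
  exists n, orbit_dist n p < e.
Proof.
move=> e0 /(_ (e / 2)) pe; apply: contrapT => ne.
have [|N _ HN] := pe; first by lra.
have := HN N.+1 (leqnSn N).
have : (N.+1 - 0)%:R * e <= orbit_sum 0 N.+1 p.
  by apply: sumr_ge_const => k; rewrite leNgt; apply/negP => pk; apply: ne; exists k.
rewrite subn0; have : (0 : R) < N.+1%:R by rewrite ltr0n.
nra.
Qed.

Section compact_space.
Hypothesis cX : compact [set: X].

Lemma orbit_dist_bounded : exists2 B, 0 < B & forall k p, orbit_dist k p <= B.
Proof.
have [B B0 HB] := compact_bounded_above (compact_setTX cX cX)
  (@continuous_mdist R X).
by exists B => // k p; exact: (HB (iter k T p.1, iter k T p.2)).
Qed.

(** Markov's inequality in one direction; in the other, the average is at most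
    the diameter times the density of the times at which
    the distance exceeds a threshold, plus that threshold. *)
Lemma banach_proximalP p : banach_proximal T p.1 p.2 <->
  forall c, 0 < c -> exists N, forall a b, (a + N <= b)%N ->
    orbit_sum a b p <= c * (b - a)%:R.
Proof.
have [B B0 HB] := orbit_dist_bounded.
split=> H e e0.
  have e2 : 0 < e / 2 by lra.
  have eB : 0 < e / 2 / B by rewrite divr_gt0.
  have := H _ e2; set A := [set m | _] => /upper_banach_density_eq0P/(_ _ eB)[N HN].
  exists N => a b /HN abN.
  have : orbit_sum a b p <= B * visits A a b + e / 2 * (b - a)%:R.
    rewrite /visits natr_sum mulr_sumr mulrC mulr_natl -sumr_const_nat -big_split/=.
    apply: ler_sum => k _; have [kA|] := boolP (k \in A).
      by rewrite mulr1 (le_trans (HB k p))//; lra.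
    rewrite mulr0 add0r notin_setE /A /= => /contrapT; exact: ltW.
  have : B * visits A a b <= B * (e / 2 / B * (b - a)%:R) by rewrite ler_wpM2l// ltW.
  rewrite [X in _ <= X]mulrA (_ : B * (e / 2 / B) = e / 2); last first.
    by rewrite mulrC divfK// gt_eqF.
  lra.
apply/upper_banach_density_eq0P; set A := [set m | _] => c c0.
have [N HN] := H (c * e) (mulr_gt0 c0 e0); exists N => a b /HN abN.
rewrite -(ler_pM2r e0) mulrAC (le_trans _ abN)//.
rewrite /visits natr_sum mulr_suml; apply: ler_sum => k _.
have [|_] := boolP (k \in A); last by rewrite mul0r orbit_dist_ge0.
by rewrite inE mul1r /A /= => /negP; rewrite -leNgt.
Qed.

(** By compactness there are [d] and [L] such that every pair with [rho < d] has a
    window of length at most [L] with average at most [e / 2]: an accumulation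
    point of counterexamples would satisfy [rho <= 0] and have all averages at
    least [e / 2].  Along an orbit staying in the region [rho < d] those windows
    can be chained, which is [tiling]. *)
Lemma Banach_mean_bound (rho : X * X -> R) : continuous T -> continuous rho ->
  (forall p, rho p <= 0 -> forall c, 0 < c -> mean_le c p) ->
  forall e, 0 < e -> exists2 d, 0 < d & exists N, forall p,
    (forall k, rho (iter k T p.1, iter k T p.2) < d) ->
    forall a b, (a + N <= b)%N -> orbit_sum a b p <= e * (b - a)%:R.
Proof.
move=> cT crho rhoP e e0; have [B B0 HB] := orbit_dist_bounded.
have [L HL] : exists L, forall p, rho p < L.+1%:R^-1 ->
    exists j, [/\ (0 < j)%N, (j <= L)%N & orbit_sum 0 j p <= e / 2 * j%:R].
  apply: contrapT => nL.
  have bad n : exists p, rho p < n.+1%:R^-1 /\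
      forall j, (0 < j)%N -> (j <= n)%N -> e / 2 * j%:R <= orbit_sum 0 j p.
    apply: contrapT => np; apply: nL; exists n => p pn.
    apply: contrapT => nj; apply: np; exists p; split=> // j j0 jn.
    by apply/ltW; rewrite ltNge; apply/negP => pj; apply: nj; exists j.
  have [w Hw] := choice bad.
  have [p wp] := compact_accumulation w (compact_setTX cX cX).
  have p0 : rho p <= 0.
    apply: (accumulation_le wp (crho p)) => d d0.
    have [N HN] := inv_small d0; exists N => n Nn; rewrite add0r.
    by rewrite (lt_trans (Hw n).1)// HN.
  have [|N _ HN] := rhoP p p0 (e / 4); first by lra.
  have := HN N.+1 (leqnSn N).
  have : e / 2 * N.+1%:R <= orbit_sum 0 N.+1 p.
    apply: (accumulation_ge wp (N := N.+1) (@orbit_sum_continuous 0 N.+1 cT p)) => n Nn.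
    exact: (Hw n).2.
  have : (0 : R) < N.+1%:R by rewrite ltr0n.
  nra.
exists L.+1%:R^-1; first by rewrite invr_gt0.
have [N HN] := natr_large (L%:R * B / (e / 2)).
exists N => p Hp a b abN; have ab : (a <= b)%N by rewrite (leq_trans _ abN)// leq_addr.
have := @tiling R (orbit_dist ^~ p) B (e / 2) L 0 (ltW B0) _ (HB^~ p) _ a (b - a)%N.
rewrite subnKC// => /(_ _ _ (leq0n a)) til.
have {}til : orbit_sum a b p <= e / 2 * (b - a)%:R + L%:R * B.
  apply: til; first by lra.
  move=> m _; have [j [j0 jL Hj]] := HL _ (Hp m); exists j; split=> //.
  by rewrite (le_trans _ Hj)// -orbit_sum_shift addn0.
have : L%:R * B / (e / 2) < (b - a)%:R by rewrite HN// leq_subRL.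
rewrite ltr_pdivrMr; lra.
Qed.

End compact_space.
End orbit_sums.

(** * The mean pseudometric *)

Section mean_pseudometric.
Context {R : realType} {X : metricType R}.
Variable T : X -> X.
Hypothesis cX : compact [set: X].
Implicit Types p : (X * X)%type.

(** This is the limit superior of the averages, as a real number. *)
Definition mean_dist p : R := inf [set c | mean_le T c p].

Lemma mean_le_mono c c' p : c <= c' -> mean_le T c p -> mean_le T c' p.
Proof.
by move=> cc'; apply: filterS => n /le_trans; apply; rewrite ler_wpM2r.
Qed.

Lemma mean_le_ge0 c p : mean_le T c p -> 0 <= c.
Proof.
move=> [N _ /(_ N.+1 (leqnSn N))/(le_trans (orbit_sum_ge0 T 0 N.+1 p))].
by rewrite pmulr_lge0// ltr0n.
Qed.

Lemma mean_dist_has_inf p : has_inf [set c | mean_le T c p].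
Proof.
split; last by exists 0 => c; exact: mean_le_ge0.
have [B B0 HB] := orbit_dist_bounded T cX; exists B; exists 0%N => // n _ /=.
by rewrite mulrC -[n in n%:R]subn0; apply: sumr_le_const.
Qed.

Lemma mean_dist_ge0 p : 0 <= mean_dist p.
Proof.
apply: lb_le_inf; first by case: (mean_dist_has_inf p).
by move=> c; exact: mean_le_ge0.
Qed.

Lemma mean_dist_le c p : mean_le T c p -> mean_dist p <= c.
Proof. by apply: ge_inf; case: (mean_dist_has_inf p). Qed.

Lemma mean_dist_lt c p : mean_dist p < c -> mean_le T c p.
Proof.
by move=> /(inf_lt (mean_dist_has_inf p).1)[d /= pd /ltW dc]; apply: mean_le_mono pd.
Qed.

(** The triangle inequality for the averages passes to eventual bounds because two
    bounds hold eventually together. *)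
Lemma mean_dist_pseudometric : is_pseudometric mean_dist.
Proof.
split=> [x|x y|x y z].
- apply/eqP; rewrite eq_le mean_dist_ge0 andbT; apply: mean_dist_le.
  exists 0%N => // n _ /=; rewrite mul0r /orbit_sum big1// => k _.
  exact: mdistxx.
- have symS n : orbit_sum T 0 n (x, y) = orbit_sum T 0 n (y, x).
    by apply: eq_bigr => k _; exact: metric_sym.
  by rewrite /mean_dist /mean_le; under eq_fun do under eq_near do rewrite symS.
- apply/ler_addgt0Pr => e e0.
  have /mean_dist_lt xy : mean_dist (x, y) < mean_dist (x, y) + e / 2 by lra.
  have /mean_dist_lt yz : mean_dist (y, z) < mean_dist (y, z) + e / 2 by lra.
  rewrite (_ : _ + e =
    (mean_dist (x, y) + e / 2) + (mean_dist (y, z) + e / 2)); last by lra.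
  apply: mean_dist_le; apply: filterS2 xy yz => n xy yz.
  rewrite mulrDl (le_trans _ (lerD xy yz))// -big_split/=.
  by apply: ler_sum => k _; exact: metric_triangle.
Qed.

(** Shifting the orbit by one step changes the sum by a single term, hence the
    averages by something that tends to 0. *)
Lemma mean_dist_nonexpanding p : mean_dist (T p.1, T p.2) <= mean_dist p.
Proof.
apply/ler_addgt0Pr => e e0.
have [N _ HN] : mean_le T (mean_dist p + e / 2) p by apply: mean_dist_lt; lra.
have [M HM] := natr_large ((mean_dist p + e / 2) / (e / 2)).
apply: mean_dist_le; exists (maxn N M) => // n /=; rewrite geq_max => /andP[Nn Mn].
have := HM n Mn; rewrite ltr_pdivrMr; last by lra.
have := HN n.+1 (leqW Nn) => /=.
rewrite {1}/orbit_sum big_ltn// [X in _ + X](orbit_sum_shift T 1 0 n p) -[n.+1%:R]natr1.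
have := orbit_dist_ge0 T 0 p; rewrite /=; lra.
Qed.

Lemma mean_dist_iter k p : mean_dist (iter k T p.1, iter k T p.2) <= mean_dist p.
Proof.
elim: k => [|k IHk]; first by case: p.
exact: (le_trans (mean_dist_nonexpanding (iter k T p.1, iter k T p.2))).
Qed.

Hypothesis meT : mean_equicontinuous T.

Lemma mean_dist_continuous : continuous mean_dist.
Proof.
apply: (pseudometric_continuous mean_dist_pseudometric) => x e e0.
have e2 : 0 < e / 2 by lra.
have [d d0 Hd] := (mean_equicontinuousP T).1 meT _ e2; exists d => // y xy.
by have := mean_dist_le (Hd (x, y) xy); lra.
Qed.

End mean_pseudometric.

(** Uniformity in the position of the interval comes from [Banach_mean_bound] with
    [rho = mean_dist T], since [T] does not expand that pseudometric. *)
Lemma mean_equicontinuous_Banach (R : realType) (X : metricType R) (T : X -> X) :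
  compact [set: X] -> continuous T -> mean_equicontinuous T ->
  forall e, 0 < e -> exists2 d : R, 0 < d & exists N, forall p, mdist p.1 p.2 < d ->
    forall a b, (a + N <= b)%N -> orbit_sum T a b p <= e * (b - a)%:R.
Proof.
move=> cX cT meT e e0.
have [p p0|d d0 [N HN]] := Banach_mean_bound cX cT (mean_dist_continuous cX meT) _ e0.
  by move=> c c0; apply: (mean_dist_lt cX); exact: le_lt_trans c0.
have d2 : 0 < d / 2 by lra.
have [h h0 Hh] := (mean_equicontinuousP T).1 meT _ d2.
exists h => //; exists N => p ph.
apply: HN => k; rewrite (le_lt_trans (mean_dist_iter T cX k p))//.
by have := mean_dist_le cX (Hh p ph); lra.
Qed.

(** * The metric quotient of a pseudometric *)

Section metric_quotient.
Local Open Scope quotient_scope.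
Context {R : realType} {X : choiceType} {rho : X * X -> R}.
Hypothesis rhoP : is_pseudometric rho.

Let null x y := rho (x, y) == 0.

Let rho_ge0 p : 0 <= rho p. Proof. exact: (@pseudometric_ge0 R). Qed.

Let null_refl : reflexive null.
Proof. by case: rhoP => r0 _ _ x; rewrite /null r0. Qed.

Let null_sym : symmetric null.
Proof. by case: rhoP => _ rs _ x y; rewrite /null rs. Qed.

Let null_trans : transitive null.
Proof.
case: rhoP => _ _ rt y x z /eqP xy /eqP yz; rewrite /null eq_le rho_ge0 andbT.
by rewrite (le_trans (rt x y z))// xy yz addr0.
Qed.

Definition null_equiv := EquivRel null null_refl null_sym null_trans.

Definition metric_quotient := {eq_quot null_equiv}.

HB.instance Definition _ := Choice.on metric_quotient.

Definition quotient_map (x : X) : metric_quotient := \pi_({eq_quot null_equiv}) x.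

Definition quotient_repr (y : metric_quotient) : X := repr (y : {eq_quot null_equiv}).

Definition quotient_dist (y z : metric_quotient) : R :=
  rho (quotient_repr y, quotient_repr z).

Lemma quotient_reprK : cancel quotient_repr quotient_map.
Proof. exact: reprK. Qed.

Lemma quotient_mapP x x' : quotient_map x = quotient_map x' <-> rho (x, x') = 0.
Proof. by split=> [/eqquotP/eqP|/eqP ?]; last exact/eqquotP. Qed.

(** Representatives are at distance zero from the points they represent, so the
    distance computed on representatives does not depend on them. *)
Lemma quotient_distE x x' :
  quotient_dist (quotient_map x) (quotient_map x') = rho (x, x').
Proof.
case: rhoP => r0 rs rt.
have E z : rho (quotient_repr (quotient_map z), z) = 0.
  by apply/quotient_mapP; rewrite quotient_reprK.
rewrite /quotient_dist; set y := quotient_repr _; set y' := quotient_repr _.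
have := E x; have := E x'; rewrite -/y -/y'.
have := rt y x y'; have := rt x x' y'; have := rt x y x'; have := rt y y' x'.
rewrite (rs x y) (rs x' y'); lra.
Qed.

Let quotient_distxx y : quotient_dist y y = 0.
Proof. by case: rhoP => r0 _ _; apply: r0. Qed.

Let quotient_dist_positivity y z : quotient_dist y z = 0 -> y = z.
Proof. by move=> /quotient_mapP; rewrite !quotient_reprK. Qed.

Let quotient_dist_sym y z : quotient_dist y z = quotient_dist z y.
Proof. by case: rhoP => _ rs _; apply: rs. Qed.

Let quotient_dist_triangle z y t :
  quotient_dist y t <= quotient_dist y z + quotient_dist z t.
Proof. by case: rhoP => _ _ rt; apply: rt. Qed.

HB.instance Definition _ := isMetric.Build R metric_quotient
  quotient_distxx quotient_dist_positivity quotient_dist_sym quotient_dist_triangle.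

Lemma mdist_quotient_map x x' :
  mdist (quotient_map x) (quotient_map x') = rho (x, x').
Proof. exact: quotient_distE. Qed.

End metric_quotient.

(** * The maximal equicontinuous factor of a mean equicontinuous system *)

(** Follow the pair backwards along preimages.  By compactness two of the backward
    pairs, at times [i < j] far apart, are close to each other; pushing both
    forward [j] steps shows that the original pair returns close to itself after
    [j - i] steps.  But after so many steps the two points are already close to
    each other, by proximality and equicontinuity. *)
Lemma equicontinuous_proximal_eq (R : realType) (Z : metricType R) (Q : Z -> Z) :
  is_system Q -> equicontinuous_system Q ->
  forall z z', (forall e, 0 < e -> exists n, mdist (iter n Q z) (iter n Q z') < e) ->
  z = z'.
Proof.
move=> [_ cZ _ sQ] eQ z z' zz'; apply: mdist_positivity; apply/eqP.
rewrite eq_le mdist_ge0 andbT; apply/ler_addgt0Pr => e e0; rewrite add0r.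
have e3 : 0 < e / 3 by lra.
have [d [d0 Hd]] := eQ _ e3.
have [N0 zN0] := zz' d d0.
(* Equicontinuity preserves closeness only at positive times, whence [N0 < n] *)
have zN n : (N0 < n)%N -> mdist (iter n Q z) (iter n Q z') < e / 3.
  move=> N0n; rewrite -(subnK (ltnW N0n)) !iterD; apply: Hd => //.
  by rewrite subn_gt0.
have preimage y : exists x, Q x = y by have [x _ xy] := sQ y I; exists x.
have [g gK] := choice preimage.
have iterK i j y : (i <= j)%N -> iter j Q (iter i g y) = iter (j - i) Q y.
  by move=> ij; rewrite -(subnK ij) iterD addnK; congr iter;
     elim: i {ij} => //= i IHi; rewrite -iterS iterSr gK.
pose w n := (iter n g z, iter n g z').
have [[p p'] wp] := compact_accumulation w (compact_setTX cZ cZ).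
have d2 : 0 < d / 2 by lra.
have pV : nbhs (p, p') [set q | mdist p q.1 < d / 2 /\ mdist p' q.2 < d / 2].
  exists ([set q | mdist p q < d / 2], [set q | mdist p' q < d / 2]); last by case.
  by split; apply/nbhs_mdist; exists (d / 2).
have [i _ [/= pi pi']] := wp _ pV 0%N.
have [j ij [/= pj pj']] := wp _ pV (i + N0.+1)%N.
have lt_ij : (i < j)%N by rewrite (leq_trans _ ij)// addnS ltnS leq_addr.
have N0ji : (N0 < j - i)%N by rewrite leq_subRL// ltnW.
have back y q : mdist q (iter i g y) < d / 2 -> mdist q (iter j g y) < d / 2 ->
    mdist (iter (j - i) Q y) y < e / 3.
  move=> qi qj; rewrite -[X in mdist _ X](_ : iter j Q (iter j g y) = y); last first.
    by rewrite iterK// subnn.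
  rewrite -(iterK _ _ _ (ltnW lt_ij)); apply: Hd; last by rewrite (leq_trans _ lt_ij).
  have := metric_triangle (iter i g y) q (iter j g y).
  rewrite (metric_sym _ q); lra.
have := back z p pi pj; have := back z' p' pi' pj'; have := zN _ N0ji.
have := metric_triangle z (iter (j - i) Q z) z'.
have := metric_triangle (iter (j - i) Q z) (iter (j - i) Q z') z'.
rewrite (metric_sym z (iter _ Q z)); lra.
Qed.

Section mean_quotient.
Context {R : realType} {X : metricType R}.
Variable T : X -> X.
Hypothesis hT : is_system T.
Hypothesis meT : mean_equicontinuous T.

Let cX : compact [set: X]. Proof. by case: hT. Qed.

Let rhoP := mean_dist_pseudometric T cX.

Let Y := metric_quotient rhoP.

Let pi : X -> Y := quotient_map rhoP.

Let S (y : Y) : Y := pi (T (quotient_repr y)).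

Let pi_reprK (y : Y) : pi (quotient_repr y) = y.
Proof. exact: quotient_reprK. Qed.

Let piT x : pi (T x) = S (pi x).
Proof.
apply/quotient_mapP; apply/eqP; rewrite eq_le (pseudometric_ge0 _ rhoP) andbT.
rewrite (le_trans (mean_dist_nonexpanding T cX (x, _)))//.
suff -> : mean_dist T (x, quotient_repr (pi x)) = 0 by [].
by apply/(quotient_mapP rhoP); rewrite -/(pi _) -/(pi _) pi_reprK.
Qed.

Let continuous_pi : continuous pi.
Proof.
apply: epsilon_delta_continuous => x e e0.
have e2 : 0 < e / 2 by lra.
have [d d0 Hd] := (mean_equicontinuousP T).1 meT _ e2; exists d => // y xy.
by rewrite mdist_quotient_map; have := mean_dist_le cX (Hd (x, y) xy); lra.
Qed.

Let S_nonexpanding k y z : mdist (iter k S y) (iter k S z) <= mdist y z.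
Proof.
have iterS x : iter k S (pi x) = pi (iter k T x).
  by elim: k => //= k ->; rewrite piT.
rewrite -[y]pi_reprK -[z]pi_reprK !iterS !mdist_quotient_map.
exact: (mean_dist_iter T cX k (_, _)).
Qed.

Let equicontinuous_factor_pi : equicontinuous_factor T S pi.
Proof.
have [[x0 _] _ cT sT] := hT.
split; last by split=> // y _; exists (quotient_repr y).
- split; first by exists (pi x0).
  + have -> : [set: Y] = pi @` [set: X].
      by apply/seteqP; split=> // y _; exists (quotient_repr y).
    by apply: continuous_compact => //; exact/continuous_subspaceT.
  + apply: epsilon_delta_continuous => y e e0; exists e => // z.
    exact/le_lt_trans/(S_nonexpanding 1).
  + move=> y _; have [x _ xy] := sT (quotient_repr y) I.
    by exists (pi x); rewrite // -piT xy pi_reprK.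
- move=> e e0; exists e; split=> // y z yz m _.
  exact: le_lt_trans (S_nonexpanding m y z) yz.
Qed.

(** A factor map to an equicontinuous system identifies points at mean distance
    zero, since these are proximal; so it descends to the quotient, and compactness
    turns this inclusion of kernels into uniform continuity of the induced map. *)
Lemma mean_quotient_max : is_max_equicontinuous_factor T S pi.
Proof.
split=> // Z Q phi [sysQ eQ [cphi sphi phiT]].
have [_ _ cT _] := hT.
have phi_iter k x : phi (iter k T x) = iter k Q (phi x).
  by elim: k => //= k <-; rewrite phiT.
have cphi2 := continuous_mdist_pullback cphi.
have phi_null p : mean_dist T p <= 0 -> mdist (phi p.1) (phi p.2) <= 0.
  move=> p0; rewrite (_ : phi p.1 = phi p.2) ?mdistxx//.
  apply: (equicontinuous_proximal_eq sysQ eQ) => e e0.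
  have [p' p'0|d d0 Hd] := compact_null_domination (compact_setTX cX cX)
    (@continuous_mdist R X) cphi2 _ e0.
  - rewrite (_ : p'.1 = p'.2) ?mdistxx//; apply: mdist_positivity.
    by apply/eqP; rewrite eq_le p'0 mdist_ge0.
  - have [n pn] := mean_le_orbit_dist_small d0
      (fun c c0 => mean_dist_lt cX (le_lt_trans p0 c0)).
    by exists n; rewrite -!phi_iter; exact: (Hd (_, _) pn).
exists (phi \o @quotient_repr _ _ _ rhoP); last first.
  move=> x /=; apply: mdist_positivity; apply/eqP; rewrite eq_le mdist_ge0 andbT.
  apply: (phi_null (_, _)) => /=; suff -> : mean_dist T (x, quotient_repr (pi x)) = 0 by [].
  by apply/(quotient_mapP rhoP); rewrite -/(pi _) -/(pi _) pi_reprK.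
have phi_eq x x' : pi x = pi x' -> phi x = phi x'.
  move=> /quotient_mapP xx'; apply: mdist_positivity; apply/eqP.
  by rewrite eq_le mdist_ge0 andbT; apply: (phi_null (_, _)); rewrite xx'.
split.
- apply: epsilon_delta_continuous => y e e0.
  have [d d0 Hd] := compact_null_domination (compact_setTX cX cX)
    (mean_dist_continuous cX meT) cphi2 phi_null e0.
  exists d => // z yz; apply: (Hd (_, _)) => /=.
  by rewrite -(mdist_quotient_map rhoP) -/(pi _) -/(pi _) !pi_reprK.
- move=> z _; have [x _ <-] := sphi z I; exists (pi x) => //=.
  by apply: phi_eq; rewrite pi_reprK.
- by move=> y /=; rewrite -phiT; apply: phi_eq; rewrite pi_reprK.
Qed.

(** On the fibres of the quotient map the mean distance vanishes along the whole
    orbit, so [Banach_mean_bound] bounds the averages over all long intervals. *)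
Lemma mean_equicontinuous_banach_proximal_extension :
  banach_proximal_extension_of_mef T.
Proof.
exists Y, S, pi; split; first exact: mean_quotient_max.
have [_ _ cT _] := hT.
move=> x1 x2 /quotient_mapP x12; apply/(banach_proximalP T cX (x1, x2)) => c c0.
have [p p0|d d0 [N HN]] := Banach_mean_bound cX cT (mean_dist_continuous cX meT) _ c0.
  by move=> e e0; apply: (mean_dist_lt cX); exact: le_lt_trans e0.
exists N => a b; apply: HN => k.
by rewrite (le_lt_trans (mean_dist_iter T cX k (x1, x2)))// x12.
Qed.

End mean_quotient.

(** Pairs with the same image have vanishing mean distance; [Banach_mean_bound],
    applied to the distance of images, extends this to pairs whose image orbits
    stay close, and by equicontinuity of the factor these include all pairs of
    nearby points. *)
Lemma banach_proximal_extension_mean_equicontinuous (R : realType)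
    (X Y : metricType R) (T : X -> X) (S : Y -> Y) (pi : X -> Y) :
  is_system T -> equicontinuous_factor T S pi -> banach_proximal_extension T pi ->
  mean_equicontinuous T.
Proof.
move=> [_ cX cT _] [_ eS [cpi _ piT]] bp; apply/mean_equicontinuousP => e e0.
have pi_iter k x : pi (iter k T x) = iter k S (pi x).
  by elim: k => //= k <-; rewrite piT.
have cpi2 := continuous_mdist_pullback cpi.
have [p p0 c c0|d d0 [N HN]] := Banach_mean_bound cX cT cpi2 _ e0.
  have /bp : pi p.1 = pi p.2.
    by apply: mdist_positivity; apply/eqP; rewrite eq_le p0 mdist_ge0.
  move=> /(banach_proximalP T cX p)/(_ _ c0)[N HN]; exists N => // n Nn.
  by have := HN 0%N n Nn; rewrite subn0.
have [h [h0 Hh]] := eS d d0.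
have m0 : 0 < Num.min d h by rewrite lt_min d0.
have [p' p'0|r r0 Hr] := compact_null_domination (compact_setTX cX cX)
    (@continuous_mdist R X) cpi2 _ m0.
- rewrite (_ : p'.1 = p'.2) ?mdistxx//; apply: mdist_positivity.
  by apply/eqP; rewrite eq_le p'0 mdist_ge0.
exists r => // p /Hr; rewrite lt_min => /andP[pd ph]; exists N => // n Nn.
rewrite -[n in n%:R]subn0; apply: HN => // -[//|k].
by rewrite !pi_iter; exact: Hh.
Qed.

(** * Broken sensitivity *)

(** A pair separated by [d] along [F] over an interval where [F] has frequency above
    [c] has average above [c * d] there, while nearby pairs have averages at most
    [c * d / 2] over all long intervals. *)
Lemma broken_sensitive_not_mean_equicontinuous (R : realType) (X : metricType R)
    (T : X -> X) : is_system T ->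
  broken_sensitive (F_pubd R) T -> ~ mean_equicontinuous T.
Proof.
move=> [[x0 _] cX cT _] [d [d0 [F [/F_pubdP[c c0 Fc] HF]]]] meT.
have cd0 : 0 < c * d / 2 by rewrite divr_gt0// mulr_gt0.
have [h h0 [N HN]] := mean_equicontinuous_Banach cX cT meT cd0.
have [N1 HN1] := natr_large (2 * c^-1).
(* The pattern only involves positive elements of F, so the point a, possibly 0,
   is dropped; taking c * (b - a) > 2 keeps this loss below half of the visits. *)
have [a [b [ab Fab]]] := Fc (maxn N N1).+1.
have lt_ab : (a < b)%N by rewrite (leq_trans _ ab)// addnS ltnS leq_addr.
have [||x1 [x2 [m [/= x1h x2h x12]]]] :=
    HF [set y | mdist x0 y < h / 2] _ _ b (leq_ltn_trans (leq0n a) lt_ab).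
- rewrite openE => y /= x0y; apply/nbhs_mdist; exists (h / 2 - mdist x0 y); first by lra.
  by move=> z yz /=; have := metric_triangle x0 y z; lra.
- by exists x0 => /=; rewrite mdistxx; lra.
have x12h : mdist x1 x2 < h.
  by have := metric_triangle x1 x0 x2; rewrite (metric_sym x1 x0); lra.
have ab1 : (m + a.+1 + N <= m + b)%N.
  by rewrite -addnA leq_add2l addSnnS (leq_trans _ ab)// leq_add2l ltnS leq_maxl.
have := HN (x1, x2) x12h (m + a.+1)%N (m + b)%N ab1; rewrite subnDl.
have : d * visits F a.+1 b <= orbit_sum T (m + a.+1) (m + b) (x1, x2).
  rewrite orbit_sum_shift /visits natr_sum mulr_sumr.
  rewrite big_nat_cond [leRHS]big_nat_cond.
  apply: ler_sum => k; rewrite andbT => /andP[ak kb].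
  have [kF|_] := boolP (k \in F); last by rewrite mulr0 orbit_dist_ge0.
  rewrite mulr1 ltW// /orbit_dist /= -!iterD [(k + m)%N]addnC; apply: x12.
  exists k => //; split; first by rewrite inE in kF.
  by rewrite /= (leq_trans _ ak)// ltnW.
have : visits F a b <= 1 + visits F a.+1 b :> R.
  by rewrite /visits big_ltn// natrD lerD2r lern1 leq_b1.
have : 2 < c * (b - a)%:R.
  rewrite mulrC -ltr_pdivrMr// HN1// leq_subRL ?(ltnW lt_ab)//.
  by rewrite (leq_trans _ ab)// leq_add2l leqW// leq_maxr.
have : (b - a.+1)%:R <= (b - a)%:R :> R by rewrite ler_nat leq_sub2l.
nra.
Qed.

Lemma minimal_dense_orbit (R : realType) (X : metricType R) (T : X -> X) :
  is_minimal T -> continuous T ->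
  forall (z : X) (U : set X), open U -> U !=set0 -> exists n, U (iter n T z).
Proof.
move=> minT cT z U oU [u Uu].
pose O := [set iter n T z | n in [set: nat]].
have clO : closure O = [set: X].
  apply: minT; first exact: closed_closure.
    by exists z; apply: subset_closure; exists 0%N.
  move=> _ [x Ox <-] V /cT/Ox[_ [[n _ <-] Vn]].
  by exists (iter n.+1 T z); split=> //; exists n.+1.
have : closure O u by rewrite clO.
by move=> /(_ U (open_nbhs_nbhs (conj oU Uu)))[_ [[n _ <-] Un]]; exists n.
Qed.

(** The separation pattern must be the same for all open sets.  It is read off from
    an accumulation point [q] of late stages of bad pairs converging to [z], and
    minimality carries neighbourhoods of [z] into every open set. *)
Lemma minimal_not_mean_equicontinuous_broken (R : realType) (X : metricType R)
    (T : X -> X) : is_system T -> is_minimal T ->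
  ~ mean_equicontinuous T -> broken_sensitive (F_pubd R) T.
Proof.
move=> [_ cX cT _] minT nme; have [B B0 HB] := orbit_dist_bounded T cX.
have [e e0 bad] : exists2 e : R, 0 < e &
    forall d : R, 0 < d -> exists2 p : X * X, mdist p.1 p.2 < d & ~ mean_le T e p.
  apply: contrapT => ne; apply: nme; apply/mean_equicontinuousP => e e0.
  apply: contrapT => nd; apply: ne; exists e => // d d0.
  apply: contrapT => np; apply: nd; exists d => // p pd.
  by apply: contrapT => pe; apply: np; exists p.
(* The windows start after time n so that the time needed to go from z to the
   open set can be subtracted. *)
have window n : exists pm : X * X * nat, [/\ mdist pm.1.1 pm.1.2 < n.+1%:R^-1,
    (n <= pm.2)%N & forall j, (0 < j)%N -> (j <= n)%N ->
     e / 2 * j%:R < orbit_sum T pm.2 (pm.2 + j) pm.1].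
  have [|p pn pe] := bad n.+1%:R^-1; first by rewrite invr_gt0.
  have [|||m nm Hm] := @persistent_window _ (orbit_dist T ^~ p) B (e / 2) e _ _ _ pe n n.
  - by lra.
  - by lra.
  - by move=> k; rewrite orbit_dist_ge0 HB.
  by exists (p, m).
have [pm Hpm] := choice window; pose x n := (pm n).1; pose m n := (pm n).2.
pose w n := ((x n).1, (iter (m n) T (x n).1, iter (m n) T (x n).2)).
(* One accumulation point for both sequences: the neighbourhoods of z and of q
   have to be visited at the same indices n. *)
have [[z q] wzq] := compact_accumulation w (compact_setTX cX (compact_setTX cX cX)).
have q_sum j : (0 < j)%N -> e / 2 * j%:R <= orbit_sum T 0 j q.
  move=> j0; apply: (accumulation_ge wzq (g := fun r => orbit_sum T 0 j r.2) (N := j)).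
    apply: (@continuous_comp _ _ _ snd (orbit_sum T 0 j)); first exact: cvg_snd.
    exact: orbit_sum_continuous.
  move=> n jn; have [_ _ /(_ j j0 jn)/ltW] := Hpm n.
  by rewrite -[X in orbit_sum _ X]addn0 orbit_sum_shift.
(* The threshold is half of the lower bound e / 2 on the averages, so by Markov's
   inequality F has frequency at least e / (4 * B); halving gives a strict bound. *)
pose F := [set k | e / 4 < orbit_dist T k q].
exists (e / 4); split; first by lra.
exists F; split.
  apply/F_pubdP; exists (e / (8 * B)); first by rewrite divr_gt0// mulr_gt0.
  move=> N; exists 0%N, N.+1; split; rewrite ?leqnSn// subn0.
  have : orbit_sum T 0 N.+1 q <= B * visits F 0 N.+1 + e / 4 * (N.+1 - 0)%:R.
    rewrite /visits natr_sum mulr_sumr mulrC mulr_natl -sumr_const_nat -big_split/=.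
    apply: ler_sum => k _; have [_|] := boolP (k \in F).
      by rewrite mulr1 (le_trans (HB k q))//; lra.
    by rewrite mulr0 add0r notin_setE /F /= => /negP; rewrite -leNgt.
  rewrite subn0; have := q_sum N.+1 isT; have : (0 : R) < N.+1%:R by rewrite ltr0n.
  move=> N0 h1 h2; rewrite -(ltr_pM2l B0).
  rewrite (_ : B * (_ * _) = e / 8 * N.+1%:R); last first.
    by rewrite mulrA invfM [e * _]mulrA [B * _]mulrC divfK// gt_eqF.
  nra.
move=> U oU U0 l l0.
have [n0 Un0] := minimal_dense_orbit minT cT z oU U0.
have : nbhs z (iter n0 T @^-1` U).
  by apply: (@iter_continuous _ _ T n0 cT z); exact: open_nbhs_nbhs.
move=> /nbhs_mdist[r r0 Hr].
have r2 : 0 < r / 2 by lra.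
(* Strict separation at finitely many times is an open condition. *)
have Fl_near : nbhs q
    [set q' | forall k, (k <= l)%N -> F k -> e / 4 < orbit_dist T k q'].
  have near_k k : F k -> nbhs q [set q' | e / 4 < orbit_dist T k q'].
    by move=> Fk; apply: (cvgr_gt _ (@orbit_dist_continuous _ _ T k cT q)).
  elim: l {l0} => [|l IHl].
    have [F0|nF0] := pselect (F 0%N).
      by apply: filterS (near_k _ F0) => q' q'0 k; rewrite leqn0 => /eqP ->.
    by apply: filterE => q' k; rewrite leqn0 => /eqP ->.
  have [Fl|nFl] := pselect (F l.+1).
    apply: filterS2 (near_k _ Fl) IHl => q' q'l Hq' k.
    by rewrite leq_eqVlt => /orP[/eqP ->//|]; rewrite ltnS; exact: Hq'.
  apply: filterS IHl => q' Hq' k.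
  by rewrite leq_eqVlt => /orP[/eqP ->//|]; rewrite ltnS; exact: Hq'.
have V_near : nbhs (z, q) [set zq | mdist z zq.1 < r / 2 /\
    forall k, (k <= l)%N -> F k -> e / 4 < orbit_dist T k zq.2].
  exists ([set z' | mdist z z' < r / 2],
    [set q' | forall k, (k <= l)%N -> F k -> e / 4 < orbit_dist T k q']); last by case.
  by split=> //; apply/nbhs_mdist; exists (r / 2).
have [N HN] := inv_small r2.
have [n Nn [/= zx Hn]] := wzq _ V_near (maxn N n0).
have [pmn nm _] := Hpm n.
move: Nn; rewrite geq_max => /andP[/HN Nn n0n]; have n0m := leq_trans n0n nm.
exists (iter n0 T (x n).1), (iter n0 T (x n).2), (m n - n0)%N; split.
- by apply: Hr; lra.
- apply/Hr/(le_lt_trans (metric_triangle z (x n).1 _)).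
  by rewrite [ltRHS]splitr ltrD// (lt_trans pmn).
move=> _ [j [Fj /andP[_ jl]] <-]; have := Hn j jl Fj.
by rewrite /orbit_dist /= -!iterD -addnA addnCA subnK// addnC.
Qed.

Theorem proposition3p12 (R : realType) (X : metricType R) (T : X -> X)
    (hT : is_system T) (hmin : is_minimal T) :
  [<-> broken_sensitive (F_pubd R) T;
       ~ mean_equicontinuous T;
       ~ banach_proximal_extension_of_mef T].
Proof.
split; first exact: broken_sensitive_not_mean_equicontinuous.
split=> [nme [Y [S [pi [[fpi _] bp]]]]|nbp].
  exact/nme/(banach_proximal_extension_mean_equicontinuous hT fpi bp).
apply: minimal_not_mean_equicontinuous_broken => // me.
exact/nbp/mean_equicontinuous_banach_proximal_extension.
Qed.
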